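(* Let $O$ be a set of observations, and let $\{\mathcal G_k\}$ be a collection of grids for $\pi(X)$, partially ordered by refinement. For each $k$, let $\mathcal F^{\mathcal G_k}_O:\mathcal G_k\rightrightarrows\mathcal G_k$ be the multivalued map associated to $O$ on $\mathcal G_k$, and let $\mathfrak M^{\mathcal G_k}$ be the finest augmented Morse decomposition of $\mathcal F^{\mathcal G_k}_O$. Then for every $\mathcal G_{k_1}<\mathcal G_{k_2}$ there is an augmented Morse decomposition morphism $\mathfrak h_{\mathcal G_{k_1}}^{\mathcal G_{k_2}}:\mathfrak M^{\mathcal G_{k_1}}\to\mathfrak M^{\mathcal G_{k_2}}$ such that $\mathfrak h_{\mathcal G_{k_2}}^{\mathcal G_{k_3}}\circ\mathfrak h_{\mathcal G_{k_1}}^{\mathcal G_{k_2}}=\mathfrak h_{\mathcal G_{k_1}}^{\mathcal G_{k_3}}$ for any $\mathcal G_{k_1}<\mathcal G_{k_2}<\mathcal G_{k_3}$.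
   Context: Setting: $X$ is a compact metric space, $f:X\to X$ is continuous, and $\pi:X\to\mathbb R^m$ is continuous. Let $\{x_i\}_{i=1}^K$ be points of $X$; for each $i$ let $N_i$ be a positive integer and $y_i^j:=\pi(f^j(x_i))$ for $0\le j\le N_i-1$. Put $\mathbf y_i=(y_i^0,\dots,y_i^{N_i-1})$; the set of observations is $O=\{\mathbf y_i\}$. A grid $\mathcal G$ on a compact metric space $Y$ (here $Y=\pi(X)\subset\mathbb R^m$) is a finite collection of nonempty compact subsets of $Y$ such that (1) $Y=\bigcup_{G\in\mathcal G}G$; (2) $G=\operatorname{cl}(\operatorname{int}(G))$ for all $G$; (3) $G\cap\operatorname{int}(H)=\emptyset$ for all $G\ne H$ in $\mathcal G$. $\mathcal G$ refines $\mathcal G'$, written $\mathcal G<\mathcal G'$, if every $G\in\mathcal G$ is contained in some $G'\in\mathcal G'$. The multivalued map associated to $O$ on $\mathcal G$ is $\mathcal F^{\mathcal G}_O(G)=\{H\in\mathcal G:$ there exist $\mathbf y_i\in O$ and $j$, $0\le j<N_i-1$, such that $y_i^j\in G$, $y_i^{j+1}\in H\}$, identified with the directed graph on $\mathcal G$ with an edge $G\to H$ whenever $H\in\mathcal F_O^{\mathcal G}(G)$; stranded vertices (those with no incoming or no outgoing edge) are trimmed from the graph (repeatedly), which does not affect the Morse decomposition. For a multivalued map $\mathcal F$, an orbit is a sequence $\{G_i\}$ with $G_{i+1}\in\mathcal F(G_i)$. The Morse sets $\mathcal S_j$ of the finest Morse decomposition are the nontrivial strongly connected components of the graph $\mathcal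 F$ (a single vertex with a loop counts as nontrivial), partially ordered by $\mathcal S_j\succeq\mathcal S_k$ iff there is an orbit from $\mathcal S_j$ to $\mathcal S_k$. The finest augmented Morse decomposition is $\mathfrak M=(\{\mathcal S_j\},\succeq,\{\mathcal F_j:\mathcal S_j\rightrightarrows\mathcal S_j\})$ with $\mathcal F_j(G)=\mathcal F(G)\cap\mathcal S_j$. A grid map morphism between multivalued maps $\mathcal F$ and $\mathcal F'$ is a single-valued map $h$ between the underlying sets with $h(\mathcal F(G))\subset\mathcal F'(h(G))$ for all $G$. An augmented Morse decomposition morphism $\mathfrak h:\mathfrak M^{\mathcal G}\to\mathfrak M^{\mathcal G'}$ is a pair $(\bar h,\{h_j\})$, where $\bar h:\{\mathcal S_j^{\mathcal G}\}\to\{\mathcal S_j^{\mathcal G'}\}$ satisfies $\bar h(\mathcal S^{\mathcal G}_j)\succeq^{\mathcal G'}\bar h(\mathcal S^{\mathcal G}_k)$ whenever $\mathcal S^{\mathcal G}_j\succeq^{\mathcal G}\mathcal S^{\mathcal G}_k$, and each $h_j:\mathcal S_j^{\mathcal G}\to\bar h(\mathcal S_j^{\mathcal G})$ is a grid map morphism for the induced restriction maps. Morphisms are composed componentwise. *)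

(* Defs.v *)
From mathcomp Require Import all_boot all_order all_algebra finmap boolp.
Set Implicit Arguments.
Unset Strict Implicit.
Unset Printing Implicit Defensive.

Local Open Scope set_scope.

Definition mvmap (V : finType) := V -> {set V}.

Definition edge (V : finType) (F : mvmap V) : rel V := fun G H => H \in F G.

Definition grid_map_morphism (V V' : finType) (F : mvmap V) (F' : mvmap V')
    (h : V -> V') : Prop :=
  forall G, h @: F G \subset F' (h G).

(* [connect (edge F) G H] is the existence of an orbit, possibly of length 0,
   from [G] to [H]. *)
Definition scc (V : finType) (F : mvmap V) (G : V) : {set V} :=
  [set H | connect (edge F) G H && connect (edge F) H G].

Definition nontrivial (V : finType) (F : mvmap V) (S : {set V}) : bool :=
  (1 < #|S|)%N || [exists G in S, G \in F G].

Definition morse (V : finType) (F : mvmap V) : {set {set V}} :=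
  [set S in [set scc F G | G : V] | nontrivial F S].

Definition orbit_from_to (V : finType) (F : mvmap V) : rel {set V} :=
  fun S T => [exists G in S, exists H in T, connect (edge F) G H].

Definition elt (T : finType) (A : {set T}) : finType := {x : T | x \in A}.

Definition restrict (V : finType) (F : mvmap V) (S : {set V}) :
    mvmap (elt S) :=
  fun G => [set H | sval H \in F (sval G)].

(* Only the data of the triple; order and connectedness properties of the Morse
   sets come with [finest_augmented_morse]. *)
Record augmented_morse (V : finType) := AugmentedMorse {
  morse_sets : {set {set V}};
  morse_ge : rel (elt morse_sets);
  morse_map : forall S : elt morse_sets, mvmap (elt (sval S))
}.
Arguments morse_ge {V} M S T : rename.
Arguments morse_map {V} M S G : rename.

Definition finest_augmented_morse (V : finType) (F : mvmap V) :
    augmented_morse V :=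
  @AugmentedMorse V (morse F)
    (fun S T => orbit_from_to F (sval S) (sval T))
    (fun S => @restrict V F (sval S)).

Record augmented_morse_morphism (V V' : finType)
    (M : augmented_morse V) (M' : augmented_morse V') := MorseMorphism {
  mor_bar : elt (morse_sets M) -> elt (morse_sets M');
  mor_barP : forall S T, morse_ge M S T -> morse_ge M' (mor_bar S) (mor_bar T);
  mor_vertex : forall S : elt (morse_sets M),
    elt (sval S) -> elt (sval (mor_bar S));
  mor_vertexP : forall S : elt (morse_sets M), grid_map_morphism
    (morse_map M S) (morse_map M' (mor_bar S)) (@mor_vertex S)
}.
Arguments mor_vertex {V V' M M'} h S G : rename.
Arguments mor_vertexP {V V' M M'} h S G : rename.

Section Composition.
Context (V1 V2 V3 : finType) (M1 : augmented_morse V1)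
  (M2 : augmented_morse V2) (M3 : augmented_morse V3).
Context (k : augmented_morse_morphism M2 M3)
  (h : augmented_morse_morphism M1 M2).

Let bar S := mor_bar k (mor_bar h S).
Let vertex S (G : elt (sval S)) : elt (sval (bar S)) :=
  mor_vertex k (mor_bar h S) (mor_vertex h S G).

Fact comp_barP S T : morse_ge M1 S T -> morse_ge M3 (bar S) (bar T).
Proof. by move=> /(mor_barP h) /(mor_barP k). Qed.

Fact comp_vertexP S :
  grid_map_morphism (morse_map M1 S) (morse_map M3 (bar S)) (@vertex S).
Proof.
move=> G; apply/subsetP => _ /imsetP[H FH ->].
apply: (subsetP (mor_vertexP k _ _)); apply: imset_f.
by apply: (subsetP (mor_vertexP h _ _)); apply: imset_f.
Qed.

Definition comp_morphism : augmented_morse_morphism M1 M3 :=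
  MorseMorphism comp_barP comp_vertexP.

End Composition.

(* Trimming stranded vertices: the vertex set is kept, and the edges touching a
   stranded vertex are removed, so that trimmed vertices become isolated. By
   [finest_augmented_morse_trim] this has no effect on the finest augmented
   Morse decomposition, so the maps below are left untrimmed. *)

Definition stranded (V : finType) (F : mvmap V) (G : V) : bool :=
  (F G == set0) || [forall H, G \notin F H].

Definition trim1 (V : finType) (F : mvmap V) : mvmap V :=
  fun G => [set H in F G | ~~ stranded F G && ~~ stranded F H].

Definition trim (V : finType) (F : mvmap V) : mvmap V :=
  iter #|V| (@trim1 V) F.

Section Trim.
Context (V : finType).
Implicit Types (F : mvmap V) (G H : V) (S T : {set V}).

Definition on_cycle F G : bool :=
  [exists H, edge F G H && connect (edge F) H G].

Lemma trim1E F G H :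
  edge (trim1 F) G H = [&& edge F G H, ~~ stranded F G & ~~ stranded F H].
Proof. by rewrite /edge inE. Qed.

Lemma connect_head (e : rel V) G H :
  connect e G H -> G != H -> exists2 A, e G A & connect e A H.
Proof.
move=> /connectP[[|A p] /= + ->]; first by rewrite eqxx.
by move=> /andP[eGA pA] _; exists A => //; apply/connectP; exists p.
Qed.

Lemma connect_tail (e : rel V) G H :
  connect e G H -> G != H -> exists2 A, connect e G A & e A H.
Proof.
move=> /connectP[p]; elim/last_ind: p => [_ ->|p A _]; first by rewrite eqxx.
rewrite rcons_path last_rcons => /andP[pp eA] -> _.
by exists (last G p) => //; apply/connectP; exists p.
Qed.

Lemma on_cycleP F G :
  reflect (exists H, [/\ connect (edge F) G H, connect (edge F) H G &
    G != H \/ edge F H H]) (on_cycle F G).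
Proof.
apply: (iffP existsP) => [[H /andP[GH HG]]|[H [GH HG]]].
  have [eGH|GH'] := eqVneq G H.
    by exists G; rewrite connect0; split => //; right; rewrite {2}eGH.
  by exists H; split => //; [exact: connect1|left].
have [<- [//|eGG]|nGH _] := eqVneq G H.
  by exists G; rewrite connect0 andbT.
have [A GA AH] := connect_head GH nGH.
by exists A; rewrite GA (connect_trans AH HG).
Qed.

Lemma nontrivial_scc F G : nontrivial F (scc F G) = on_cycle F G.
Proof.
apply/orP/on_cycleP => [[|/exists_inP[H]]|[H [GH HG]]].
- move=> /card_gt1P[A [B [+ + AB]]]; rewrite !inE.
  move=> /andP[GA AG] /andP[GB BG].
  have [eGA|nGA] := eqVneq G A; last by exists A; split => //; left.
  by exists B; split => //; left; rewrite eGA.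
- by rewrite inE => /andP[GH HG] HH; exists H; split => //; right.
have HS : H \in scc F G by rewrite inE GH.
case=> [nGH|HH]; last by right; apply/exists_inP; exists H.
by left; apply/card_gt1P; exists G, H; rewrite inE connect0.
Qed.

Lemma morseP F S :
  reflect (exists2 G, on_cycle F G & S = scc F G) (S \in morse F).
Proof.
rewrite inE; apply: (iffP andP) => [[/imsetP[G _ ->]]|[G cG ->]].
  by rewrite nontrivial_scc => cG; exists G.
by rewrite nontrivial_scc imset_f.
Qed.

Lemma on_cycle_scc F G H : on_cycle F G -> H \in scc F G -> on_cycle F H.
Proof.
move=> /on_cycleP[A [GA AG nA]]; rewrite inE => /andP[GH HG].
have [eGH|nGH] := eqVneq G H; first by apply/on_cycleP; exists A; rewrite -eGH.
by apply/on_cycleP; exists G; split => //; left; rewrite eq_sym.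
Qed.

Lemma on_cycle_stranded F G : on_cycle F G -> ~~ stranded F G.
Proof.
move=> /existsP[H /andP[GH HG]]; rewrite negb_or; apply/andP; split.
  by apply/set0Pn; exists H.
rewrite negb_forall; apply/existsP.
have [eHG|nHG] := eqVneq H G; first by exists G; rewrite negbK -{1}eHG.
by have [A _ AG] := connect_tail HG nHG; exists A; rewrite negbK.
Qed.

Lemma morse_stranded F S G : S \in morse F -> G \in S -> ~~ stranded F G.
Proof.
move=> /morseP[H cH ->] GH; apply: on_cycle_stranded.
exact: on_cycle_scc GH.
Qed.

Lemma connect_trim1W F G H :
  connect (edge (trim1 F)) G H -> connect (edge F) G H.
Proof.
by apply: connect_sub => A B; rewrite trim1E => /andP[AB _]; exact: connect1.
Qed.

Lemma connect_trim1 F G H : ~~ stranded F G -> ~~ stranded F H ->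
  connect (edge (trim1 F)) G H = connect (edge F) G H.
Proof.
move=> + sH; move=> sG; apply/idP/idP; first exact: connect_trim1W.
move=> /connectP[p]; elim: p G sG => [|A p IHp] G sG /=.
  by move=> _ ->; exact: connect0.
move=> /andP[GA pA] lH.
have sA : ~~ stranded F A.
  case: p pA lH {IHp} => [_ /= <- //|B p /= /andP[AB _] _].
  rewrite negb_or; apply/andP; split; first by apply/set0Pn; exists B.
  by rewrite negb_forall; apply/existsP; exists G; rewrite negbK.
by apply: connect_trans (IHp A sA pA lH); rewrite connect1// trim1E GA sG.
Qed.

Lemma on_cycle_trim1 F G : on_cycle (trim1 F) G = on_cycle F G.
Proof.
apply/idP/idP => [/existsP[H]|cG].
  rewrite trim1E => /andP[/andP[GH _]] /connect_trim1W HG.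
  by apply/existsP; exists H; rewrite GH.
have sG := on_cycle_stranded cG.
have /existsP[H /andP[GH HG]] := cG.
have sH : ~~ stranded F H.
  by apply/on_cycle_stranded/(on_cycle_scc cG); rewrite inE connect1.
by apply/existsP; exists H; rewrite trim1E GH sG sH connect_trim1.
Qed.

Lemma scc_trim1 F G : on_cycle F G -> scc (trim1 F) G = scc F G.
Proof.
move=> cG; apply/setP => H; apply/idP/idP.
  by rewrite !inE => /andP[/connect_trim1W-> /connect_trim1W->].
move=> HG; have sH := on_cycle_stranded (on_cycle_scc cG HG).
by move: HG; rewrite !inE !connect_trim1// on_cycle_stranded.
Qed.

Lemma morse_trim1 F : morse (trim1 F) = morse F.
Proof.
apply/setP => S; apply/morseP/morseP => -[G cG ->]; exists G => //.
- by rewrite -on_cycle_trim1.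
- by rewrite scc_trim1// -on_cycle_trim1.
- by rewrite on_cycle_trim1.
- by rewrite scc_trim1.
Qed.

Let mk (A : {set {set V}}) (r : rel {set V}) (m : forall S, mvmap (elt S)) :=
  @AugmentedMorse V A (fun S T : elt A => r (sval S) (sval T))
    (fun S : elt A => m (sval S)).

Let mk_eq (A : {set {set V}}) (r r' : rel {set V})
    (m m' : forall S, mvmap (elt S)) :
    (forall S T, S \in A -> T \in A -> r S T = r' S T) ->
    (forall S, S \in A -> m S = m' S) -> mk A r m = mk A r' m'.
Proof.
move=> rr' mm'; rewrite /mk; congr AugmentedMorse.
  by apply/funext => -[S SA]; apply/funext => -[T TA]; exact: rr'.
by apply: functional_extensionality_dep => -[S SA]; exact: mm'.
Qed.

Lemma finest_augmented_morse_trim1 F :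
  finest_augmented_morse (trim1 F) = finest_augmented_morse F.
Proof.
rewrite -[LHS]/(mk _ (orbit_from_to (trim1 F)) (@restrict V (trim1 F))).
rewrite -[RHS]/(mk _ (orbit_from_to F) (@restrict V F)) morse_trim1.
apply: mk_eq => [S T SF TF|S SF].
  apply: eq_existsb => G; case GS: (G \in S) => //=.
  apply: eq_existsb => H; case HT: (H \in T) => //=.
  by rewrite connect_trim1// (morse_stranded SF GS, morse_stranded TF HT).
apply/funext => -[G GS]; apply/setP => -[H HS]; rewrite !inE /=.
by rewrite (morse_stranded SF GS) (morse_stranded SF HS) !andbT.
Qed.

Lemma finest_augmented_morse_trim F :
  finest_augmented_morse (trim F) = finest_augmented_morse F.
Proof.
by rewrite /trim; elim: #|V| => //= n; rewrite finest_augmented_morse_trim1.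
Qed.

End Trim.

From mathcomp Require Import all_classical all_reals all_analysis.

Import numFieldNormedType.Exports.

Local Close Scope set_scope.
Local Open Scope fset_scope.
Local Open Scope classical_set_scope.
Local Open Scope ring_scope.

Record grid (Y : topologicalType) := Grid {
  cells :> {fset set Y};
  grid_nonempty : forall G, G \in cells -> G !=set0;
  grid_compact : forall G, G \in cells -> compact G;
  grid_cover : \bigcup_(G in [set` cells]) G = [set: Y];
  grid_regular : forall G, G \in cells -> G = closure G°;
  grid_separated : forall G H, G \in cells -> H \in cells -> G != H ->
    G `&` H° = set0
}.

Definition refines (Y : topologicalType) (G G' : grid Y) : Prop :=
  forall A, A \in cells G -> exists2 B, B \in cells G' & A `<=` B.

Definition observation (R : realType) (X : Type) (f : X -> X) (m : nat)
    (pi : X -> 'rV[R]_m) (x : X) (n : nat) : seq 'rV[R]_m :=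
  mkseq (fun j => pi (iter j f x)) n.

Definition observations (R : realType) (X : Type) (f : X -> X) (m : nat)
    (pi : X -> 'rV[R]_m) (K : nat) (x : 'I_K -> X) (N : 'I_K -> nat) :
    set (seq 'rV[R]_m) :=
  range (fun i => observation f pi (x i) (N i)).

(* The cells are subsets of the subspace [A] of R^m (with its own topology,
   in which interiors and closures are taken); [set_val @` G] is the cell [G]
   seen as a subset of R^m. *)
Definition observed_map (R : realType) (m : nat) (A : set 'rV[R]_m)
    (O : set (seq 'rV[R]_m)) (G : grid A) : mvmap G :=
  fun B => [set C : G | `[< exists y j, [/\ O y, (j < (size y).-1)%N,
    (set_val @` val B) y`_j & (set_val @` val C) y`_(j.+1)] >]]%SET.

(* Main.v *)
Require Import Defs.
From HB Require Import structures.
From mathcomp Require Import all_boot all_order all_algebra finmap.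
From mathcomp Require Import all_classical all_reals all_analysis.
Set Implicit Arguments.
Unset Strict Implicit.
Unset Printing Implicit Defensive.
Import numFieldNormedType.Exports.
Local Open Scope classical_set_scope.

(** A cell has nonempty interior and distinct cells have disjoint interiors, so a
    cell of a finer grid lies in exactly one cell of the coarser grid. This
    inclusion map is a graph morphism of the observed maps, hence sends nontrivial
    strongly connected components into such components, and its uniqueness makes
    the construction functorial. *)

Section Lift.
Context (V V' : finType) (F : mvmap V) (F' : mvmap V') (h : V -> V')
  (hP : grid_map_morphism F F' h).

Lemma edge_morphism A B : edge F A B -> edge F' (h A) (h B).
Proof. by move=> AB; apply: (fintype.subsetP (hP A)); exact: imset_f. Qed.

Lemma connect_morphism A B :
  connect (edge F) A B -> connect (edge F') (h A) (h B).
Proof.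
move=> /connectP[p]; elim: p A => [A _ -> //|C p IHp A /= /andP[AC pC] lB].
exact: connect_trans (connect1 (edge_morphism AC)) (IHp C pC lB).
Qed.

(** Nontriviality is carried by [on_cycle] rather than by cardinality: if [h] collapses a cycle to
    one vertex, its edges survive there as a loop. *)
Lemma on_cycle_morphism A : on_cycle F A -> on_cycle F' (h A).
Proof.
move=> /existsP[B /andP[AB BA]]; apply/existsP; exists (h B).
by rewrite edge_morphism// connect_morphism.
Qed.

(* The union over all of [S] avoids choosing a representative: when [S] is a
   Morse set, all the components in it coincide. *)
Definition lift_set (S : {set V}) : {set V'} :=
  (\bigcup_(A in S) scc F' (h A))%SET.

Lemma mem_lift_set (S : {set V}) A : A \in S -> h A \in lift_set S.
Proof. by move=> AS; apply/bigcupP; exists A; rewrite // inE connect0. Qed.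

(** Paths push forward in both directions, so [h] sends every vertex of the component of [A] into
    the component of [h A]. *)
Lemma lift_set_scc A : lift_set (scc F A) = scc F' (h A).
Proof.
apply/setP => C; apply/bigcupP/idP => [[B]|CA]; last first.
  by exists A; rewrite // inE connect0.
rewrite !inE => /andP[/connect_morphism AB /connect_morphism BA] /andP[BC CB].
by rewrite (connect_trans AB BC) (connect_trans CB BA).
Qed.

Lemma lift_set_morse S : S \in morse F -> lift_set S \in morse F'.
Proof.
move=> /morseP[A cA ->]; rewrite lift_set_scc.
by apply/morseP; exists (h A) => //; exact: on_cycle_morphism.
Qed.

Definition lift_bar (S : elt (morse F)) : elt (morse F') :=
  exist _ (lift_set (sval S)) (lift_set_morse (svalP S)).

Definition lift_vertex (S : elt (morse F)) (A : elt (sval S)) :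
    elt (sval (lift_bar S)) :=
  exist _ (h (sval A)) (mem_lift_set (svalP A)).

Lemma lift_barP (S T : elt (morse F)) :
  orbit_from_to F (sval S) (sval T) ->
  orbit_from_to F' (sval (lift_bar S)) (sval (lift_bar T)).
Proof.
move=> /exists_inP[A AS /exists_inP[B BT AB]].
apply/exists_inP; exists (h A); first exact: mem_lift_set.
apply/exists_inP; exists (h B); first exact: mem_lift_set.
exact: connect_morphism.
Qed.

Lemma lift_vertexP (S : elt (morse F)) : grid_map_morphism
  (@Defs.restrict V F (sval S)) (@Defs.restrict V' F' (sval (lift_bar S)))
  (@lift_vertex S).
Proof.
move=> A; apply/fintype.subsetP => _ /imsetP[B + ->]; rewrite !inE.
exact: edge_morphism.
Qed.

Definition lift_morphism : augmented_morse_morphism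
    (finest_augmented_morse F) (finest_augmented_morse F') :=
  @MorseMorphism V V' (finest_augmented_morse F) (finest_augmented_morse F')
    lift_bar lift_barP lift_vertex lift_vertexP.

End Lift.

(** The type of [mor_vertex h S A] depends on [mor_bar h], so vertices are compared through their
    values in [V'], which avoids a transport. *)
Lemma eq_augmented_morse_morphism (V V' : finType)
    (M : augmented_morse V) (M' : augmented_morse V')
    (h k : augmented_morse_morphism M M') :
  (forall S, sval (mor_bar h S) = sval (mor_bar k S)) ->
  (forall S A, sval (mor_vertex h S A) = sval (mor_vertex k S A)) ->
  h = k.
Proof.
case: h k => [hb hbP hv hvP] [kb kbP kv kvP] /= eb ev.
have ebar : hb = kb by apply/funext => S; apply: val_inj; exact: eb.
(* Once the maps on Morse sets are identified, [hv] and [kv] have the same type. *)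
case: _ / ebar in kbP kv kvP ev {eb} *.
have evert : hv = kv.
  apply: functional_extensionality_dep => S; apply/funext => A.
  by apply: val_inj; exact: ev.
case: _ / evert in kvP {ev} *.
by rewrite (Prop_irrelevance hbP kbP) (Prop_irrelevance hvP kvP).
Qed.

Lemma comp_lift_morphism (V1 V2 V3 : finType) (F1 : mvmap V1) (F2 : mvmap V2)
    (F3 : mvmap V3) (h12 : V1 -> V2) (h23 : V2 -> V3) (h13 : V1 -> V3)
    (p12 : grid_map_morphism F1 F2 h12) (p23 : grid_map_morphism F2 F3 h23)
    (p13 : grid_map_morphism F1 F3 h13) :
  h23 \o h12 =1 h13 ->
  comp_morphism (lift_morphism p23) (lift_morphism p12) = lift_morphism p13.
Proof.
move=> eh; apply: eq_augmented_morse_morphism => [[S /= SM]|S A]; last exact: eh.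
(* With a representative [A], each lift is the component of an image of [A], so only
   [h23 (h12 A) = h13 A] is needed. *)
have /morseP[A _ ->] := SM.
by rewrite (lift_set_scc p12) (lift_set_scc p23) (lift_set_scc p13) -eh.
Qed.

Lemma cell_sub_unique (Y : topologicalType) (G G' : grid Y) (A B C : set Y) :
  A \in cells G -> B \in cells G' -> C \in cells G' ->
  A `<=` B -> A `<=` C -> B = C.
Proof.
move=> AG BG CG AB AC; apply/eqP; apply: contrapT => /negP BC.
(* The interior of [A] lies both in [B] and in the interior of [C], which do not meet. *)
have A0 : A° = set0.
  rewrite -subset0 -(grid_separated BG CG BC) => y Ay; split.
    exact/AB/(interior_subset Ay).
  exact: interiorS AC _ Ay.
(* [A] is the closure of its empty interior, yet it has a point. *)
have [y] := grid_nonempty AG.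
by rewrite (grid_regular AG) A0 closure0.
Qed.

Section Coarsen.
Context (Y : topologicalType) (G G' : grid Y) (r : refines G G').

Lemma coarsen_ex (A : G) : exists B : G', val A `<=` val B.
Proof. by have [B BG AB] := r (valP A); exists [` BG]%fset. Qed.

Definition coarsen (A : G) : G' := sval (cid (coarsen_ex A)).

Lemma sub_coarsen A : val A `<=` val (coarsen A).
Proof. exact: svalP (cid (coarsen_ex A)). Qed.

(** Makes the arbitrary choice by [cid] canonical, hence independent of the proof of refinement. *)
Lemma coarsen_unique (A : G) (B : G') : val A `<=` val B -> coarsen A = B.
Proof.
move=> AB; apply: val_inj.
exact: (cell_sub_unique (valP A) (valP _) (valP _) (@sub_coarsen A) AB).
Qed.

End Coarsen.

Lemma coarsen_comp (Y : topologicalType) (G1 G2 G3 : grid Y)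
    (r12 : refines G1 G2) (r23 : refines G2 G3) (r13 : refines G1 G3) :
  coarsen r23 \o coarsen r12 =1 coarsen r13.
Proof.
move=> A; apply/esym/coarsen_unique.
exact: subset_trans (@sub_coarsen _ _ _ _ _) (@sub_coarsen _ _ _ _ _).
Qed.

(** Coarsening only enlarges cells, so the observation [y] and index [j] that witness an edge also
    witness it between the coarser cells. *)
Lemma coarsen_morphism (R : realType) (m : nat) (A : set 'rV[R]_m)
    (O : set (seq 'rV[R]_m)) (G G' : grid A) (r : refines G G') :
  grid_map_morphism (observed_map O (G := G)) (observed_map O (G := G'))
    (coarsen r).
Proof.
move=> B; apply/fintype.subsetP => _ /imsetP[C + ->]; rewrite !inE.
move=> [y [j [Oy jy By Cy]]]; exists y, j; split => //.
  exact: image_subset (@sub_coarsen _ _ _ r B) _ By.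
exact: image_subset (@sub_coarsen _ _ _ r C) _ Cy.
Qed.

Theorem corollary7p2 (R : realType) (X : metricType R)
    (cptX : compact [set: X])
    (f : X -> X) (cf : continuous f)
    (m : nat) (pi : X -> 'rV[R]_m) (cpi : continuous pi)
    (K : nat) (x : 'I_K -> X) (N : 'I_K -> nat)
    (N_gt0 : forall i, (0 < N i)%N)
    (I : Type) (G : I -> grid (range pi)) :
  let O := observations f pi x N in
  let M := fun k => finest_augmented_morse (observed_map O (G := G k)) in
  exists h : forall k1 k2, refines (G k1) (G k2) ->
      augmented_morse_morphism (M k1) (M k2),
    forall (k1 k2 k3 : I) (r12 : refines (G k1) (G k2))
      (r23 : refines (G k2) (G k3)) (r13 : refines (G k1) (G k3)),
      comp_morphism (h k2 k3 r23) (h k1 k2 r12) = h k1 k3 r13.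
Proof.
exists (fun k1 k2 r => lift_morphism (coarsen_morphism _ r)) => *.
exact/comp_lift_morphism/coarsen_comp.
Qed.
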